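(* Let $p \in \mathbb{Z}^n$ with all components positive, $r \in \mathbb{Z}^n$, and let $k$ and $M$ be integers with $$0 \le k < \sum_{i=1}^n p_i, \qquad M > 2\sqrt{n}\,(\|r\|+1)^2\|p\| + 1 .$$ Then there are integers $\beta_1,\beta_2$ satisfying $$kM + \sqrt{n}\,\|r\| < \beta_1 \le \beta_2 < -\sqrt{n}\,\|r\| + (k+1)M ,$$ and for all such $(\beta_1,\beta_2)$ the problem $$\text{(KP)}\qquad \beta_1 \le ax \le \beta_2,\quad 0 \le x \le u,\quad x \in \mathbb{Z}^n$$ with $a = pM + r$ and $u = e$ (the vector of all ones) has the following properties: 1. Its infeasibility is proven by $px \le k \,\vee\, px \ge k+1$. 2. Ordinary branch-and-bound needs at least $2^{\ell(p,k)}$ nodes to prove its infeasibility, regardless of the order in which the branching variables are chosen. 3. The infeasibility of its rangespace reformulation computed with KZ-reduction is proven at the root node by branching on the last variable, i.e. $y_n$ is nonintegral for every $y$ in the LP relaxation of the reformulation.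
   Context: $\|\cdot\|$ is the Euclidean norm; $px$, $ax$ denote inner products. The LP relaxation of an integer program is obtained by dropping integrality of the variables. Split disjunction: the infeasibility of an integer program is proven by $px \le k \vee px \ge k+1$ if both $\{x : px \le k\}$ and $\{x : px \ge k+1\}$ have empty intersection with the feasible set of its LP relaxation. $\ell(p,k)$: with $N=\{1,\dots,n\}$ and $p(S)=\sum_{i\in S}p_i$ for $S \subseteq N$, $$\ell(p,k)=\max\{\ell : p(F)\le k \text{ and } p(N\setminus F)\ge k+1 \text{ for all } F\subseteq N \text{ with } |F|=\ell\}.$$ Ordinary branch-and-bound means branch-and-bound branching on individual variables. A node is identified by a node-fixing $(\bar x,F)$: a set $F\subseteq N$ of fixed variables and integers $\bar x_i$, $0\le \bar x_i\le u_i$ $(i\in F)$. Variables are chosen for branching in some order $x_{j_1},\dots,x_{j_n}$; the root has $F=\emptyset$; a node with $F=\{j_1,\dots,j_t\}$, $t<n$, generates one node for each integer value that $x_{j_{t+1}}$ can take such that the LP relaxation of (KP) with the resulting fixings is feasible. A node is pruned only when its LP relaxation is infeasible (such nodes are not counted). The number of nodes is the total number of nodes so generated. Rangespace reformulation: let $A=\begin{pmatrix} a\\ I_n\end{pmatrix}$ and let $U$ be an $n\times n$ unimodular matrix (integral, determinant $\pm1$) such that the columns of $AU$ are a reduced basis (here: KZ-reduced) of the lattice $\{Ax : x\in\mathbb{Z}^n\}$. The reformulation is: $\beta_1\le (aU)y\le\beta_2$, $0\le Uy\le u$, $y\in\mathbb{Z}^n$. KZ-reduction (Korkhine–Zolotarev):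 for linearly independent $b_1,\dots,b_n$ with Gram–Schmidt vectors $b_1^*,\dots,b_n^*$, write $b_i=\sum_{j\le i}\mu_{ij}b_j^*$ with $\mu_{ii}=1$, put $b_i(k)=\sum_{j=k}^i\mu_{ij}b_j^*$ for $1\le k\le i$, and let $L_i$ be the lattice generated by $b_i(i),b_{i+1}(i),\dots,b_n(i)$. The basis is KZ-reduced if $b_i(i)$ is a shortest (nonzero) vector of $L_i$ for all $i$. *)

(* Defs.v *)
From mathcomp Require Import all_boot all_order all_algebra all_fingroup.
From mathcomp Require Import boolp classical_sets reals.

Set Implicit Arguments.
Unset Strict Implicit.
Unset Printing Implicit Defensive.

Import Order.TTheory GRing.Theory Num.Theory.
Local Open Scope classical_set_scope.
Local Open Scope ring_scope.

Section Euclidean.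
Variable R : realType.

Definition intr_mx (m n : nat) (X : 'M[int]_(m, n)) : 'M[R]_(m, n) :=
  map_mx intr X.

(* The Euclidean norm of a row or column vector; the library norm `|X| is the
   maximum norm. *)
Definition enorm (m n : nat) (X : 'M[R]_(m, n)) : R :=
  Num.sqrt (\sum_i \sum_j X i j ^+ 2).

Definition dot (m : nat) (v w : 'cV[R]_m) : R := \sum_i v i 0 * w i 0.

Definition ip (n : nat) (p : 'rV[int]_n) (x : 'cV[R]_n) : R :=
  (intr_mx p *m x) 0 0.

End Euclidean.

Section KorkhineZolotarev.
Variables (R : realType) (m n : nat) (B : 'M[R]_(m, n)).

(* [gs_rec d i] is the Gram-Schmidt vector b_i^* of the columns of B as soon as
   the recursion depth d exceeds i. *)
Fixpoint gs_rec (d : nat) (i : 'I_n) : 'cV[R]_m :=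
  if d is d'.+1 then
    col i B - \sum_(j < n | (j < i)%N)
      (dot (col i B) (gs_rec d' j) / dot (gs_rec d' j) (gs_rec d' j))
        *: gs_rec d' j
  else 0.

Definition gs (i : 'I_n) : 'cV[R]_m := gs_rec i.+1 i.

Definition gs_coef (i j : 'I_n) : R :=
  if j == i then 1 else dot (col i B) (gs j) / dot (gs j) (gs j).

(* The vector b_i(k). *)
Definition gs_proj (i k : 'I_n) : 'cV[R]_m :=
  \sum_(j < n | (k <= j <= i)%N) gs_coef i j *: gs j.

(* The lattice L_i generated by b_i(i), ..., b_n(i). *)
Definition proj_lattice (i : 'I_n) : set 'cV[R]_m :=
  [set v | exists z : 'I_n -> int,
     v = \sum_(j < n | (i <= j)%N) (z j)%:~R *: gs_proj j i].

Definition shortest_vector (L : set 'cV[R]_m) (v : 'cV[R]_m) : Prop :=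
  [/\ L v, v != 0 & forall w, L w -> w != 0 -> enorm v <= enorm w].

(* Linear independence of the columns of B is implied: the vectors
   b_i(i) = b_i^* are required to be nonzero. *)
Definition KZ_reduced : Prop :=
  forall i : 'I_n, shortest_vector (proj_lattice i) (gs_proj i i).

End KorkhineZolotarev.

Section Knapsack.
Variables (R : realType) (n : nat).
Variables (a : 'rV[int]_n) (b1 b2 : int) (u : 'cV[int]_n).

Definition KP_LP : set 'cV[R]_n :=
  [set x | b1%:~R <= ip a x <= b2%:~R /\
           forall i, 0 <= x i 0 <= (u i 0)%:~R].

(* A node-fixing (xbar, F); the entries of xbar outside F are irrelevant. *)
Definition node : Type := ('cV[int]_n * {set 'I_n})%type.

Definition root_node : node := (0, finset.set0).

Definition node_LP (N : node) : set 'cV[R]_n :=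
  [set x | KP_LP x /\ forall i, i \in N.2 -> x i 0 = (N.1 i 0)%:~R].

Definition node_feasible (N : node) : bool := `[< node_LP N !=set0 >].

Definition fix_var (N : node) (j : 'I_n) (v : int) : node :=
  (\col_i (if i == j then v else N.1 i 0), (j |: N.2)%SET).

Definition children (N : node) (j : 'I_n) : seq node :=
  [seq N' <- [seq fix_var N j v%:Z | v <- iota 0 (absz (u j 0)).+1]
     | node_feasible N'].

Fixpoint subtree (js : seq 'I_n) (N : node) : seq node :=
  N :: (if js is j :: js'
        then flatten [seq subtree js' N' | N' <- children N j] else [::]).

(* The nodes of ordinary branch-and-bound, the root included, when the
   variables are branched on in the order x_(s 0), x_(s 1), ... *)
Definition bb_nodes (s : 'S_n) : seq node :=
  if node_feasible root_node then subtree [seq s t | t <- enum 'I_n] root_node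
  else [::].

Definition rangespace_LP (U : 'M[int]_n) : set 'cV[R]_n :=
  [set y | b1%:~R <= ip (a *m U) y <= b2%:~R /\
           forall i, 0 <= (intr_mx R U *m y) i 0 <= (u i 0)%:~R].

(* Since U is unimodular, the columns of A U generate { A x : x integral }. *)
Definition KZ_rangespace (U : 'M[int]_n) : Prop :=
  U \in unitmx /\ KZ_reduced (intr_mx R (col_mx a 1%:M *m U)).

End Knapsack.

Arguments KP_LP R [n] a b1 b2 u _.
Arguments rangespace_LP R [n] a b1 b2 u U _.

Definition proven_by_split (R : realType) (n : nat) (Q : set 'cV[R]_n)
    (p : 'rV[int]_n) (k : int) : Prop :=
  Q `&` [set x | ip p x <= k%:~R] = set0 /\
  Q `&` [set x | (k + 1)%:~R <= ip p x] = set0.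

(* The condition on l is vacuous for l > n, whence the restriction to l <= n;
   for p > 0 and 0 <= k < p(N) it holds at l = 0, so that the maximum is over
   a nonempty set. *)
Definition ell (n : nat) (p : 'rV[int]_n) (k : int) : nat :=
  \max_(l < n.+1 | [forall F : {set 'I_n}, (#|F| == l) ==>
     (\sum_(i in F) p 0 i <= k) && (k + 1 <= \sum_(i in ~: F) p 0 i)]) l.

(* Main.v *)
Require Import Defs.
From mathcomp Require Import all_boot all_order all_algebra all_fingroup.
From mathcomp Require Import boolp classical_sets reals.
From mathcomp Require Import lra ring.

(** Everything rests on [a x = M (p x) + r x], where [M] dwarfs the second term.

    On the unit box [`|r x| <= sqrt n * |r|], so [p x <= k] pushes [a x] below
    [b1] and [k + 1 <= p x] pushes it above [b2] ([ip_lt_b1], [b2_lt_ip]).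
    This is the split proof of infeasibility.  The same two facts keep
    branch-and-bound busy: if at most [ell p k] variables are fixed at 0 or 1,
    putting all the others at 0 gives [p x <= k] and putting them all at 1
    gives [k + 1 <= p x], so somewhere on the segment between these two points
    [a x = b1] and the node is LP-feasible ([node_feasible_01]).  Hence the
    tree is a complete binary tree down to depth [ell p k]
    ([size_subtree_ge]), whatever the branching order.

    For the reformulation, write [A] for [a] stacked on the identity.  The
    point is that [p U] vanishes except in its last entry
    ([KZ_split_direction]).  Suppose that [j] is the first index at which
    [(p U)_j] is nonzero and that [j] is not the last one.  The vectors
    [p_s e_t - p_t e_s] span the orthogonal complement of [p] and cannot all
    lie in the span of the columns of [U] other than the last one, so one of
    them, [x], has a nonzero last coordinate in the basis [U]
    ([short_ker_vector]).  It is short: since [p x = 0],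
    [|A x| <= (|r| + 1) |x| <= (|r| + 1) |p|].  Its projection is a nonzero
    vector of the [j]-th projected lattice, so the Gram-Schmidt vector [b_j^*]
    is at most as long as [A x] ([KZ_gs_le]).  But [b_j^* = A z] with
    [p z = (p U)_j] a nonzero integer ([mul_gs]), so that
    [|a z| >= M - |r| |z|] makes it long, contradicting the size of [M].

    Now [p x = (p U)_n y_n] for [x = U y].  If [y_n] were integral, then so
    would be [p x], and every integer is on one side of the split. *)

Import Order.TTheory GRing.Theory Num.Theory.
Local Open Scope classical_set_scope.
Local Open Scope ring_scope.

(** * Euclidean norm and inner products *)

Section Norm.
Variable R : realType.

Lemma dotE (m : nat) (v w : 'cV[R]_m) : dot v w = (v^T *m w) 0 0.
Proof. by rewrite mxE; apply: eq_bigr => i _; rewrite mxE. Qed.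

Lemma dotC (m : nat) (v w : 'cV[R]_m) : dot v w = dot w v.
Proof. by apply: eq_bigr => i _; rewrite mulrC. Qed.

Lemma dot0l (m : nat) (v : 'cV[R]_m) : dot 0 v = 0.
Proof. by rewrite dotE trmx0 mul0mx mxE. Qed.

Lemma dotBr (m : nat) (v w w' : 'cV[R]_m) :
  dot v (w - w') = dot v w - dot v w'.
Proof. by rewrite !dotE mulmxBr !mxE. Qed.

Lemma dotZr (m : nat) (c : R) (v w : 'cV[R]_m) :
  dot v (c *: w) = c * dot v w.
Proof. by rewrite !dotE -scalemxAr mxE. Qed.

Lemma dot_sumr (m : nat) (I : finType) (P : pred I) (v : 'cV[R]_m)
    (F : I -> 'cV[R]_m) :
  dot v (\sum_(i | P i) F i) = \sum_(i | P i) dot v (F i).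
Proof.
by rewrite dotE mulmx_sumr summxE; apply: eq_bigr => i _; rewrite -dotE.
Qed.

Lemma dot_ge0 (m : nat) (v : 'cV[R]_m) : 0 <= dot v v.
Proof. by apply: sumr_ge0 => i _; rewrite -expr2 sqr_ge0. Qed.

Lemma dot_eq0 (m : nat) (v : 'cV[R]_m) : (dot v v == 0) = (v == 0).
Proof.
apply/eqP/eqP => [v0|->]; last by rewrite dotE mulmx0 mxE.
apply/matrixP => i j; rewrite ord1 mxE; apply/eqP.
have := @psumr_eq0P _ _ xpredT (fun i => v i 0 * v i 0).
by move=> /(_ (fun i _ => sqr_ge0 (v i 0)) v0 i isT)/eqP; rewrite mulf_eq0 orbb.
Qed.

Lemma enorm_ge0 (m n : nat) (X : 'M[R]_(m, n)) : 0 <= enorm X.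
Proof. exact: sqrtr_ge0. Qed.

Lemma enorm_sqr (m n : nat) (X : 'M[R]_(m, n)) :
  enorm X ^+ 2 = \sum_i \sum_j X i j ^+ 2.
Proof.
by rewrite sqr_sqrtr //; do 2![apply: sumr_ge0 => ? _]; rewrite sqr_ge0.
Qed.

Lemma enorm_sqr_dot (m : nat) (v : 'cV[R]_m) : enorm v ^+ 2 = dot v v.
Proof. by rewrite enorm_sqr; apply: eq_bigr => i _; rewrite big_ord1 expr2. Qed.

Lemma enorm_tr (m n : nat) (X : 'M[R]_(m, n)) : enorm X^T = enorm X.
Proof.
rewrite /enorm exchange_big; congr Num.sqrt.
by do 2![apply: eq_bigr => ? _]; rewrite mxE.
Qed.

Lemma enorm_col_mx_sqr (m1 m2 : nat) (v : 'cV[R]_(m1 + m2)) :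
  enorm v ^+ 2 = enorm (usubmx v) ^+ 2 + enorm (dsubmx v) ^+ 2.
Proof.
rewrite !enorm_sqr big_split_ord /=.
by congr (_ + _); do 2![apply: eq_bigr => ? _]; rewrite mxE.
Qed.

(** Cauchy-Schwarz, from [0 <= |(w . w) v - (v . w) w|^2]. *)
Lemma dot_le_enorm (m : nat) (v w : 'cV[R]_m) :
  `|dot v w| <= enorm v * enorm w.
Proof.
rewrite -(@ler_pXn2r _ 2) ?nnegrE ?mulr_ge0 ?enorm_ge0 ?normr_ge0 //.
rewrite real_normK ?num_real // exprMn !enorm_sqr_dot.
have [->|w0] := eqVneq w 0.
  by rewrite !dotE !mulmx0 !mxE mulr0 expr0n.
have w_gt0 : 0 < dot w w by rewrite lt_neqAle eq_sym dot_eq0 w0 dot_ge0.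
have := dot_ge0 _ (dot w w *: v - dot v w *: w).
rewrite dotBr !dotZr ![dot (_ - _) _]dotC !dotBr !dotZr [dot w v]dotC => h.
have {}h : 0 <= dot w w * (dot v v * dot w w - dot v w ^+ 2) by nra.
by rewrite pmulr_rge0 // subr_ge0 in h.
Qed.

Lemma ip_le_enorm (n : nat) (p : 'rV[int]_n) (x : 'cV[R]_n) :
  `|ip p x| <= enorm (intr_mx R p) * enorm x.
Proof.
have -> : ip p x = dot (intr_mx R p)^T x by rewrite dotE trmxK.
by rewrite -[enorm (intr_mx R p)]enorm_tr dot_le_enorm.
Qed.

Lemma ip_sum (n : nat) (p : 'rV[int]_n) (x : 'cV[R]_n) :
  ip p x = \sum_i (p 0 i)%:~R * x i 0.
Proof. by rewrite /ip mxE; apply: eq_bigr => i _; rewrite mxE. Qed.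

Lemma ip_intr_mx (n : nat) (p : 'rV[int]_n) (x : 'cV[int]_n) :
  ip p (intr_mx R x) = ((p *m x) 0 0)%:~R.
Proof. by rewrite /ip -map_mxM mxE. Qed.

Lemma ip_mulmx (n : nat) (p : 'rV[int]_n) (U : 'M[int]_n) (y : 'cV[R]_n) :
  ip (p *m U) y = ip p (intr_mx R U *m y).
Proof. by rewrite /ip /intr_mx map_mxM mulmxA. Qed.

Lemma ip_comb (n : nat) (M : int) (p r : 'rV[int]_n) (x : 'cV[R]_n) :
  ip (M *: p + r) x = M%:~R * ip p x + ip r x.
Proof.
by rewrite /ip /intr_mx map_mxD map_mxZ mulmxDl -scalemxAl !mxE.
Qed.

Lemma enorm_box_le (n : nat) (x : 'cV[R]_n) :
  (forall i, 0 <= x i 0 <= 1) -> enorm x <= Num.sqrt n%:R.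
Proof.
move=> x01; rewrite ler_wsqrtr // -[n in n%:R]card_ord -sumr_const.
apply: ler_sum => i _; rewrite big_ord1.
by have /andP[? ?] := x01 i; rewrite exprn_ile1.
Qed.

Lemma ip_box_le (n : nat) (r : 'rV[int]_n) (x : 'cV[R]_n) :
  (forall i, 0 <= x i 0 <= 1) ->
  `|ip r x| <= Num.sqrt n%:R * enorm (intr_mx R r).
Proof.
move=> x01; apply: le_trans (ip_le_enorm _ r x) _.
by rewrite mulrC ler_wpM2r ?enorm_ge0 ?enorm_box_le.
Qed.

Lemma enorm_pos_ge1 (n : nat) (p : 'rV[int]_n) :
  (0 < n)%N -> (forall i, 0 < p 0 i) -> 1 <= enorm (intr_mx R p).
Proof.
case: n p => // n p _ p_gt0; rewrite -sqrtr1 ler_wsqrtr // big_ord1.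
rewrite big_ord_recl mxE -[X in X <= _]addr0 lerD //; last first.
  by apply: sumr_ge0 => i _; rewrite sqr_ge0.
by rewrite exprn_ege1 // ler1z -gtz0_ge1.
Qed.

End Norm.

(** * Gram-Schmidt vectors and KZ-reduced bases *)

Section GramSchmidt.
Variables (R : realType) (m n : nat) (B : 'M[R]_(m, n)).

Local Notation gs := (gs B).
Local Notation gs_coef := (gs_coef B).
Local Notation gs_proj := (gs_proj B).

Lemma gs_rec_depth (d : nat) (i : 'I_n) : (i < d)%N -> gs_rec B d i = gs i.
Proof.
suff indep d1 d2 (j : 'I_n) :
    (j < d1)%N -> (j < d2)%N -> gs_rec B d1 j = gs_rec B d2 j.
  by move=> lt_id; apply: indep.
elim: d1 d2 j => // d1 IHd [|d2] // j lt1 lt2 /=; congr (_ - _).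
apply: eq_bigr => l lt_lj.
by rewrite (IHd d2 l) ?(leq_trans lt_lj).
Qed.

Lemma gs_colE (i : 'I_n) :
  gs i = col i B - \sum_(j < n | (j < i)%N) gs_coef i j *: gs j.
Proof.
rewrite {1}/Defs.gs /=; congr (_ - _); apply: eq_bigr => j lt_ji.
by rewrite gs_rec_depth // /gs_coef -val_eqE ltn_eqF.
Qed.

Lemma col_gsE (i : 'I_n) :
  col i B = \sum_(j < n | (j <= i)%N) gs_coef i j *: gs j.
Proof.
rewrite (bigD1 i) //= {1}/Defs.gs_coef eqxx scale1r gs_colE.
rewrite (eq_bigl (fun j : 'I_n => (j < i)%N)) ?subrK // => j.
by rewrite andbC -val_eqE ltn_neqAle.
Qed.

Lemma gs_proj_diag (i : 'I_n) : gs_proj i i = gs i.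
Proof.
rewrite /Defs.gs_proj (big_pred1 i) => [|j].
  by rewrite /Defs.gs_coef eqxx scale1r.
by rewrite -eqn_leq eq_sym.
Qed.

(** Linearly dependent columns cause no trouble: a zero Gram-Schmidt vector
    gets the coefficient [_ / 0 = 0] and is orthogonal to everything. *)
Lemma gs_orthogonal (i j : 'I_n) : i != j -> dot (gs i) (gs j) = 0.
Proof.
suff orth d (l k : 'I_n) : l = d :> nat -> (k < l)%N -> dot (gs k) (gs l) = 0.
  rewrite -val_eqE neq_ltn => /orP[lt_ij|lt_ji]; first exact: orth lt_ij.
  by rewrite dotC; exact: orth lt_ji.
elim/ltn_ind: d l k => d IHd l k ld lt_kl.
rewrite [gs l]gs_colE dotBr dot_sumr (bigD1 k) //= big1; last first.
  move=> h /andP[lt_hl neq_hk]; rewrite dotZr.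
  move: neq_hk; rewrite -val_eqE neq_ltn => /orP[lt_hk|lt_kh].
    by rewrite dotC (IHd k) ?mulr0 // -ld.
  by rewrite (IHd h) ?mulr0 // -ld.
rewrite addr0 dotZr /Defs.gs_coef -val_eqE ltn_eqF // [dot (col _ _) _]dotC.
have [gk0|gk0] := eqVneq (dot (gs k) (gs k)) 0; last by rewrite divfK ?subrr.
move/eqP: gk0; rewrite dot_eq0 => /eqP ->.
by rewrite !dot0l mulr0 subrr.
Qed.

Lemma dot_gs_sum (P : pred 'I_n) (c : 'I_n -> R) :
  dot (\sum_(i | P i) c i *: gs i) (\sum_(i | P i) c i *: gs i)
    = \sum_(i | P i) c i ^+ 2 * dot (gs i) (gs i).
Proof.
rewrite dot_sumr; apply: eq_bigr => i Pi; rewrite dotZr dotC dot_sumr.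
rewrite (bigD1 i) //= big1 ?addr0 => [|j /andP[_ neq_ji]].
  by rewrite dotZr mulrA -expr2.
by rewrite dotZr gs_orthogonal ?mulr0 // eq_sym.
Qed.

(** The coordinate of the lattice vector [B z] on the Gram-Schmidt vector
    [gs k]. *)
Definition gs_coord (z : 'cV[int]_n) (k : 'I_n) : R :=
  \sum_(j < n | (k <= j)%N) (z j 0)%:~R * gs_coef j k.

Lemma lattice_gs_coord (z : 'cV[int]_n) :
  B *m intr_mx R z = \sum_k gs_coord z k *: gs k.
Proof.
have -> : B *m intr_mx R z = \sum_j (z j 0)%:~R *: col j B.
  apply/matrixP => a b; rewrite ord1 mxE summxE.
  by apply: eq_bigr => j _; rewrite !mxE mulrC.
under eq_bigr do rewrite col_gsE scaler_sumr.
rewrite (exchange_big_dep xpredT) //=; apply: eq_bigr => k _.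
by rewrite scaler_suml; apply: eq_bigr => j _; rewrite scalerA.
Qed.

(** Projecting [B z] orthogonally to the first columns drops its first
    Gram-Schmidt coordinates and leaves the other ones unchanged. *)
Lemma proj_lattice_gs_coord (i : 'I_n) (z : 'cV[int]_n) :
  \sum_(j < n | (i <= j)%N) (z j 0)%:~R *: gs_proj j i
    = \sum_(k < n | (i <= k)%N) gs_coord z k *: gs k.
Proof.
under eq_bigr do rewrite scaler_sumr.
rewrite (exchange_big_dep (fun k : 'I_n => (i <= k)%N)) //=; last first.
  by move=> j k _ /andP[].
apply: eq_bigr => k le_ik; rewrite scaler_suml; apply: eq_big => [j|j _].
  rewrite le_ik /=.
  by case: (leqP k j) => [/(leq_trans le_ik) ->|]; rewrite ?andbF.
by rewrite scalerA.
Qed.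

Lemma gs_neq0 (i : 'I_n) : KZ_reduced B -> gs i != 0.
Proof. by case/(_ i); rewrite gs_proj_diag. Qed.

(** The projection of [B z] to the [i]-th projected lattice is no longer than
    [B z], and it is nonzero: at the last index [l] with [z l 0 != 0] its
    Gram-Schmidt coordinate is [z l 0] itself. *)
Lemma KZ_gs_le (i j : 'I_n) (z : 'cV[int]_n) :
  KZ_reduced B -> (i <= j)%N -> z j 0 != 0 ->
  enorm (gs i) <= enorm (B *m intr_mx R z).
Proof.
move=> KZ le_ij zj0; have [_ _ min_i] := KZ i.
pose w := \sum_(k < n | (i <= k)%N) gs_coord z k *: gs k.
have w_lat : proj_lattice B i w.
  by exists (fun j => z j 0); rewrite proj_lattice_gs_coord.
have [l zl0 max_l] := @arg_maxnP _ j (fun k => z k 0 != 0) val zj0.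
have coord_l : gs_coord z l = (z l 0)%:~R.
  rewrite /gs_coord (bigD1 l) //= big1 ?addr0 => [|k /andP[le_lk neq_kl]].
    by rewrite /Defs.gs_coef eqxx mulr1.
  have [->|/max_l le_kl] := eqVneq (z k 0) 0; first by rewrite mul0r.
  by move: neq_kl; rewrite -val_eqE eqn_leq le_lk andbT => /negP.
have gs2_gt0 : 0 < dot (gs l) (gs l).
  by rewrite lt_neqAle eq_sym dot_eq0 gs_neq0 // dot_ge0.
have w0 : w != 0.
  rewrite -dot_eq0 dot_gs_sum gt_eqF // (bigD1 l) /=; last first.
    exact: leq_trans le_ij (max_l j zj0).
  apply: ltr_wpDr.
    by apply: sumr_ge0 => k _; rewrite mulr_ge0 ?sqr_ge0 ?dot_ge0.
  by rewrite coord_l mulr_gt0 // exprn_even_gt0 //= intr_eq0.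
rewrite -gs_proj_diag; apply: le_trans (min_i w w_lat w0) _.
rewrite -(@ler_pXn2r _ 2) ?nnegrE ?enorm_ge0 // !enorm_sqr_dot.
rewrite lattice_gs_coord !dot_gs_sum.
rewrite [leRHS](bigID (fun k : 'I_n => (i <= k)%N)) /= lerDl.
by apply: sumr_ge0 => k _; rewrite mulr_ge0 ?sqr_ge0 ?dot_ge0.
Qed.

(** [gs i] differs from the [i]-th column by a combination of earlier columns,
    which a linear form vanishing on these columns does not see. *)
Lemma mul_gs (W : 'rV[R]_m) (i : 'I_n) :
  (forall j : 'I_n, (j < i)%N -> W *m col j B = 0) ->
  W *m gs i = W *m col i B.
Proof.
suff gsW d (l : 'I_n) : l = d :> nat ->
    (forall j : 'I_n, (j < l)%N -> W *m col j B = 0) ->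
    W *m gs l = W *m col l B by exact: gsW.
elim/ltn_ind: d l => d IHd l ld W0.
rewrite gs_colE mulmxBr mulmx_sumr big1 ?subr0 // => j lt_jl.
rewrite -scalemxAr (IHd j) -?ld ?W0 ?scaler0 // => k lt_kj.
exact: W0 (ltn_trans lt_kj lt_jl).
Qed.

End GramSchmidt.

(** * The split disjunction and branch-and-bound *)

Section Split.
Variables (R : realType) (n : nat) (p r : 'rV[int]_n) (k M b1 b2 : int).

Local Notation a := (M *: p + r).
Local Notation err := (Num.sqrt n%:R * enorm (intr_mx R r)).

Hypothesis M_gt0 : 0 < M.
Hypothesis b1_gt : (k * M)%:~R + err < b1%:~R.
Hypothesis b2_lt : b2%:~R < - err + ((k + 1) * M)%:~R.

Lemma ip_lt_b1 (x : 'cV[R]_n) :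
  (forall i, 0 <= x i 0 <= 1) -> ip p x <= k%:~R -> ip a x < b1%:~R.
Proof.
move=> /(ip_box_le _ _ r); rewrite ler_norml => /andP[_ rx_le] px_le.
apply: le_lt_trans b1_gt; rewrite ip_comb lerD // intrM mulrC.
by rewrite ler_wpM2r // ler0z ltW.
Qed.

Lemma b2_lt_ip (x : 'cV[R]_n) :
  (forall i, 0 <= x i 0 <= 1) -> (k + 1)%:~R <= ip p x -> b2%:~R < ip a x.
Proof.
move=> /(ip_box_le _ _ r); rewrite ler_norml => /andP[rx_ge _] px_ge.
apply: lt_le_trans b2_lt _; rewrite ip_comb addrC lerD // intrM mulrC.
by rewrite ler_wpM2l // ler0z ltW.
Qed.

Lemma KP_LP_proven_by_split :
  proven_by_split (KP_LP R a b1 b2 (const_mx 1)) p k.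
Proof.
by split; apply/seteqP; split=> x //= -[[/andP[b1_le le_b2] xu]];
  (have x01 i : 0 <= x i 0 <= 1 by have := xu i; rewrite mxE);
  [move/(ip_lt_b1 _ x01)|move/(b2_lt_ip _ x01)]; rewrite ltNge ?b1_le ?le_b2.
Qed.

(** Setting the free variables to 0 or to 1 gives points [x 0] and [x 1] on the
    two sides of the split, hence on the two sides of the knapsack constraint;
    [a x = b1] is solved on the segment between them. *)
Lemma node_feasible_01 (l : nat) (N : node n) :
  (forall i, 0 < p 0 i) -> b1 <= b2 ->
  (forall F : {set 'I_n}, #|F| = l ->
     \sum_(i in F) p 0 i <= k /\ k + 1 <= \sum_(i in ~: F) p 0 i) ->
  (#|N.2| <= l <= n)%N -> (forall i, i \in N.2 -> 0 <= N.1 i 0 <= 1) ->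
  node_feasible R a b1 b2 (const_mx 1) N.
Proof.
case: N => v F /= p_gt0 le_b12 Hl /andP[le_Fl le_ln] v01.
(* The hypothesis speaks of sets of exactly l elements: enlarge F to such a
   set G, whose two bounds imply those for F because p is positive. *)
have [G [sFG cG]] : exists G : {set 'I_n}, F \subset G /\ #|G| = l.
  elim: l {Hl} le_Fl le_ln => [|l IHl] le_Fl le_ln.
    by exists F; split=> //; apply/eqP; rewrite -leqn0.
  case: (ltngtP #|F| l.+1) le_Fl => // [lt_Fl _|eqFl _]; last by exists F.
  have [G [sFG cG]] := IHl lt_Fl (ltnW le_ln).
  have /card_gt0P[x] : (0 < #|~: G|)%N.
    by rewrite -(ltn_add2l #|G|) addn0 cardsC card_ord cG.
  rewrite inE => xG; exists (x |: G)%SET; split.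
    exact: fintype.subset_trans sFG (finset.subsetU1 _ _).
  by rewrite cardsU1 xG cG.
have [pG_le pG_ge] := Hl G cG.
pose x c : 'cV[R]_n := \col_i (if i \in F then (v i 0)%:~R else c).
have x01 c : 0 <= c <= 1 -> forall i, 0 <= x c i 0 <= 1.
  by move=> c01 i; rewrite mxE; case: ifPn => // /v01; rewrite ler0z lerz1.
have ip_x0 : ip a (x 0) < b1%:~R.
  apply: ip_lt_b1; first by apply: x01; rewrite lexx ler01.
  have: (\sum_(i in G) p 0 i)%:~R <= k%:~R :> R by rewrite ler_int.
  apply: le_trans; rewrite ip_sum rmorph_sum /= [leRHS]big_mkcond /=.
  apply: ler_sum => i _; rewrite mxE.
  have pi_ge0 : 0 <= (p 0 i)%:~R :> R by rewrite ler0z ltW.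
  case: ifPn => [iF|_]; last by rewrite mulr0; case: ifP.
  rewrite (fintype.subsetP sFG) // ler_piMr // lerz1.
  by have /andP[] := v01 i iF.
have ip_x1 : b2%:~R < ip a (x 1).
  apply: b2_lt_ip; first by apply: x01; rewrite ler01 lexx.
  have: (k + 1)%:~R <= (\sum_(i in ~: G) p 0 i)%:~R :> R by rewrite ler_int.
  move/le_trans; apply; rewrite ip_sum rmorph_sum /= [leLHS]big_mkcond /=.
  apply: ler_sum => i _; rewrite mxE inE.
  have pi_ge0 : 0 <= (p 0 i)%:~R :> R by rewrite ler0z ltW.
  case: ifPn => [iG|].
    by rewrite ifN ?mulr1 //; apply: contra iG; apply: (fintype.subsetP sFG).
  rewrite negbK => _; rewrite mulr_ge0 //; case: ifPn => // iF.
  by rewrite ler0z; have /andP[] := v01 i iF.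
have le_b12R : b1%:~R <= b2%:~R :> R by rewrite ler_int.
have gap : 0 < ip a (x 1) - ip a (x 0) by lra.
pose c := (b1%:~R - ip a (x 0)) / (ip a (x 1) - ip a (x 0)).
have c01 : 0 <= c <= 1.
  by rewrite /c divr_ge0 ?ler_pdivrMr //=; lra.
have ip_xc : ip a (x c) = b1%:~R.
  have -> : ip a (x c) = ip a (x 0) + c * (ip a (x 1) - ip a (x 0)).
    rewrite !ip_sum -sumrB mulr_sumr -big_split /=; apply: eq_bigr => i _.
    by rewrite !mxE; case: ifP => _; ring.
  by rewrite /c divfK ?gt_eqF // addrC subrK.
apply/asboolP; exists (x c); split; last by move=> i /= iF; rewrite mxE iF.
split; first by rewrite ip_xc lexx.
by move=> i; rewrite [const_mx 1 _ _]mxE; apply: x01.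
Qed.

End Split.

(** As long as fewer than [l] variables are fixed, both children of a node are
    feasible, so the subtree doubles at each level. *)
Lemma size_subtree_ge (R : realType) (n : nat) (a : 'rV[int]_n) (b1 b2 : int)
    (l : nat) (js : seq 'I_n) (N : node n) :
  (forall N' : node n, (#|N'.2| <= l)%N ->
     (forall i, i \in N'.2 -> 0 <= N'.1 i 0 <= 1) ->
     node_feasible R a b1 b2 (const_mx 1) N') ->
  uniq js -> (forall j, j \in js -> j \notin N.2) ->
  (l <= #|N.2| + size js)%N -> (forall i, i \in N.2 -> 0 <= N.1 i 0 <= 1) ->
  (2 ^ (l - #|N.2|) <= size (subtree R a b1 b2 (const_mx 1%R) js N))%N.
Proof.
move=> feasible; elim: js N => [|j js IHjs] N.
  by move=> _ _; rewrite addn0 -subn_eq0 => /eqP ->.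
case/andP=> j_js uniq_js js_free le_l N01 /=.
case: (leqP l #|N.2|) => [|lt_Nl]; first by rewrite -subn_eq0 => /eqP ->.
have jN : j \notin N.2 by rewrite js_free ?mem_head.
have cardN v : #|(fix_var N j v).2| = #|N.2|.+1 by rewrite cardsU1 jN.
have fix01 (v : int) : 0 <= v <= 1 ->
    forall i, i \in (fix_var N j v).2 -> 0 <= (fix_var N j v).1 i 0 <= 1.
  move=> v01 i; rewrite !inE mxE; case: eqP => //= _; exact: N01.
have IH (v : int) : 0 <= v <= 1 -> (2 ^ (l - #|N.2|.+1) <=
    size (subtree R a b1 b2 (const_mx 1%R) js (fix_var N j v)))%N.
  move=> v01; rewrite -(cardN v); apply: IHjs => //; last exact: fix01.
    move=> i i_js; rewrite !inE negb_or js_free ?inE ?i_js ?orbT // andbT.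
    by apply: contraNneq j_js => <-.
  by rewrite cardN addSn -addnS.
have -> : children R a b1 b2 (const_mx 1) N j
          = [:: fix_var N j 0; fix_var N j 1].
  by rewrite /children mxE /= !feasible ?cardN //; apply: fix01.
rewrite /= cats0 size_cat -(subnSK lt_Nl) expnS mul2n -addnn.
by apply/leqW/leq_add; apply: IH.
Qed.

(** The maximum defining [ell] is attained, because [l = 0] qualifies. *)
Lemma ell_spec (n : nat) (p : 'rV[int]_n) (k : int) :
  0 <= k < \sum_i p 0 i ->
  (ell p k <= n)%N /\
  forall F : {set 'I_n}, #|F| = ell p k ->
    \sum_(i in F) p 0 i <= k /\ k + 1 <= \sum_(i in ~: F) p 0 i.
Proof.
move=> /andP[k_ge0 k_lt]; rewrite /ell.
pose P (l : 'I_n.+1) := [forall F : {set 'I_n}, (#|F| == l) ==>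
  (\sum_(i in F) p 0 i <= k) && (k + 1 <= \sum_(i in ~: F) p 0 i)].
have P0 : P ord0.
  apply/forallP => F; apply/implyP; rewrite cards_eq0 => /eqP ->.
  rewrite big_set0 k_ge0 finset.setC0 (eq_bigl xpredT) ?lezD1 // => i.
  by rewrite inE.
have [|l Pl ->] := @eq_bigmax_cond _ P (fun l => l : nat).
  by apply/card_gt0P; exists ord0.
split; first by rewrite -ltnS.
by move=> F /eqP cF; have /forallP/(_ F) := Pl; rewrite cF => /andP[].
Qed.

(** * Short vectors orthogonal to p *)

(** For [s != t], the vector [p_s e_t - p_t e_s], which is orthogonal to [p]. *)
Definition swap_vec {n : nat} (p : 'rV[int]_n) (s t : 'I_n) : 'cV[int]_n :=
  \col_i (if i == t then p 0 s else if i == s then - p 0 t else 0).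

Lemma sum_swap_vec (V : nmodType) (n : nat) (p : 'rV[int]_n) (s t : 'I_n)
    (F : 'I_n -> int -> V) :
  s != t -> (forall i, F i 0 = 0) ->
  \sum_i F i (swap_vec p s t i 0) = F t (p 0 s) + F s (- p 0 t).
Proof.
move=> neq_st F0; rewrite (bigD1 t) //= mxE eqxx; congr (_ + _).
rewrite (bigD1 s) //= mxE (negbTE neq_st) eqxx big1 ?addr0 // => i.
by case/andP=> /negbTE it /negbTE is_; rewrite mxE it is_.
Qed.

Lemma mul_swap_vec (n : nat) (p w : 'rV[int]_n) (s t : 'I_n) : s != t ->
  (w *m swap_vec p s t) 0 0 = p 0 s * w 0 t - p 0 t * w 0 s.
Proof.
move=> neq_st; rewrite mxE (sum_swap_vec _ _ p s t (fun i x => w 0 i * x)) //.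
  by rewrite mulrN ![w 0 _ * _]mulrC.
by move=> i; rewrite mulr0.
Qed.

Lemma enorm_swap_vec (R : realType) (n : nat) (p : 'rV[int]_n) (s t : 'I_n) :
  s != t -> enorm (intr_mx R (swap_vec p s t)) <= enorm (intr_mx R p).
Proof.
move=> neq_st; apply: ler_wsqrtr; rewrite big_ord1.
rewrite (eq_bigr (fun i => (swap_vec p s t i 0)%:~R ^+ 2)); last first.
  by move=> i _; rewrite big_ord1 mxE.
rewrite (sum_swap_vec _ _ p s t (fun _ x => x%:~R ^+ 2)) //; last first.
  by move=> _; rewrite expr0n.
rewrite (bigD1 s) //= (bigD1 t) 1?eq_sym //= !mxE rmorphN sqrrN addrA.
by rewrite lerDl sumr_ge0 // => i _; rewrite sqr_ge0.
Qed.

(** * The rangespace reformulation *)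

Lemma col_mulmx (T : pzRingType) (m n q : nat) (A : 'M[T]_(m, n))
    (B : 'M[T]_(n, q)) (j : 'I_q) :
  col j (A *m B) = A *m col j B.
Proof. by rewrite !colE mulmxA. Qed.

Section Reformulation.
Variables (R : realType) (n : nat) (p r : 'rV[int]_n) (M : int).
Variable U : 'M[int]_n.

Local Notation a := (M *: p + r).

Hypothesis p_gt0 : forall i, 0 < p 0 i.
Hypothesis M_gt :
  (enorm (intr_mx R r) + 1) ^+ 2 * enorm (intr_mx R p) < M%:~R.
Hypothesis U_unit : U \in unitmx.

Lemma enorm_augmented_sqr (y : 'cV[R]_n) :
  enorm (intr_mx R (col_mx a 1%:M) *m y) ^+ 2 = ip a y ^+ 2 + enorm y ^+ 2.
Proof.
rewrite /intr_mx map_col_mx map_mx1 mul_col_mx mul1mx enorm_col_mx_sqr.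
by rewrite col_mxKu col_mxKd enorm_sqr_dot /dot big_ord1 -expr2.
Qed.

(** On the kernel of [p] the large multiplier [M] disappears from [a]. *)
Lemma enorm_augmented_ker (x : 'cV[int]_n) : p *m x = 0 ->
  enorm (intr_mx R (col_mx a 1%:M) *m intr_mx R x)
    <= (enorm (intr_mx R r) + 1) * enorm (intr_mx R x).
Proof.
move=> px0.
rewrite -(@ler_pXn2r _ 2) ?nnegrE ?mulr_ge0 ?addr_ge0 ?enorm_ge0 //.
rewrite enorm_augmented_sqr ip_comb [ip p _]ip_intr_mx px0 mxE mulr0 add0r.
have rx_le : ip r (intr_mx R x) ^+ 2
             <= (enorm (intr_mx R r) * enorm (intr_mx R x)) ^+ 2.
  rewrite -[leLHS]real_normK ?num_real // ler_pXn2r ?ip_le_enorm //.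
    by rewrite nnegrE.
  by rewrite nnegrE mulr_ge0 ?enorm_ge0.
have := enorm_ge0 _ _ _ (intr_mx R r); have := enorm_ge0 _ _ _ (intr_mx R x).
set X := enorm _ in rx_le *; set Y := enorm _ in rx_le * => X_ge0 Y_ge0.
have : 0 <= X * X * Y by rewrite !mulr_ge0.
by nra.
Qed.

(** If every [p_s e_t - p_t e_s] had [l]-th coordinate 0 in the basis [U], then
    the [l]-th row [w] of the inverse of [U] would be proportional to [p], and
    [p U] would be proportional to [w U = e_l], contrary to its nonzero [i]-th
    entry. *)
Lemma short_ker_vector (i l : 'I_n) : i != l -> (p *m U) 0 i != 0 ->
  exists x : 'cV[int]_n, [/\ p *m x = 0, (invmx U *m x) l 0 != 0
    & enorm (intr_mx R x) <= enorm (intr_mx R p)].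
Proof.
move=> neq_il pUi; pose w := row l (invmx U).
have wU : w *m U = row l 1%:M by rewrite -row_mul mulVmx.
have w_mul x : (invmx U *m x) l 0 = (w *m x) 0 0 by rewrite -row_mul [RHS]mxE.
clearbody w.
have [/existsP[s /existsP[t pw]]|par] :=
    boolP [exists s, exists t, p 0 s * w 0 t != p 0 t * w 0 s].
  have neq_st : s != t by apply: contraNneq pw => ->.
  exists (swap_vec p s t); split; last exact: enorm_swap_vec.
    by apply/matrixP => u v; rewrite !ord1 mul_swap_vec // mulrC subrr mxE.
  by rewrite w_mul mul_swap_vec // subr_eq0.
have wp : p 0 l *: w = w 0 l *: p.
  apply/matrixP => u v; rewrite !ord1 !mxE [RHS]mulrC; apply/eqP.
  apply: contraNT par => pw.
  by apply/existsP; exists l; apply/existsP; exists v.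
have pU_l : p 0 l *: row l 1%:M = w 0 l *: (p *m U).
  by rewrite scalemxAl -wp -scalemxAl wU.
move: (p *m U) pU_l pUi => q pU_l qi.
have wl0 : w 0 l = 0.
  have /eqP := congr1 (fun X : 'rV[int]_n => X 0 i) pU_l.
  rewrite !mxE [l == i]eq_sym (negbTE neq_il) mulr0 eq_sym mulf_eq0.
  by rewrite (negbTE qi) orbF => /eqP.
have /eqP := congr1 (fun X : 'rV[int]_n => X 0 l) pU_l.
by rewrite wl0 scale0r !mxE eqxx mulr1 gt_eqF.
Qed.

Hypothesis KZ : KZ_reduced (intr_mx R (col_mx a 1%:M *m U)).

(** At the first [j] with [(p U)_j != 0], the vector [b_j^*] would be both at
    most [(|r| + 1) |p|] long, by comparison with a short vector in the kernel
    of [p], and of the form [A z] with [p z] a nonzero integer, which forces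
    [M <= (|r| + 1)^2 |p|]. *)
Lemma KZ_split_direction (i l : 'I_n) : (i < l)%N -> (p *m U) 0 i = 0.
Proof.
suff split_d d (j : 'I_n) : j = d :> nat -> (j < l)%N -> (p *m U) 0 j = 0.
  exact: split_d.
elim/ltn_ind: d j => d IHd j jd lt_jl; apply/eqP; apply/negPn/negP => pUj.
pose A := intr_mx R (col_mx a 1%:M).
pose g := gs (intr_mx R (col_mx a 1%:M *m U)) j.
have gE : g = col_mx (usubmx g) (dsubmx g) by rewrite vsubmxK.
have AU : intr_mx R (col_mx a 1%:M *m U) = A *m intr_mx R U by exact: map_mxM.
have neq_jl : j != l by rewrite -val_eqE ltn_eqF.
have [x [px0 Ux_l x_le]] := short_ker_vector j l neq_jl pUj.
have g_le : enorm g <= (enorm (intr_mx R r) + 1) * enorm (intr_mx R p).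
  apply: le_trans (KZ_gs_le _ _ _ _ j l _ KZ (ltnW lt_jl) Ux_l) _.
  rewrite /intr_mx -map_mxM -mulmxA mulKVmx // map_mxM.
  apply: le_trans (enorm_augmented_ker x px0) _.
  by rewrite ler_wpM2l // addr_ge0 ?enorm_ge0.
(* By induction the linear form p on the lower block vanishes on the columns
   before j, so it takes the same value on b_j^* as on the column j. *)
have pg : ip p (dsubmx g) = ((p *m U) 0 j)%:~R.
  have colW (h : 'I_n) : row_mx 0 (intr_mx R p) *m col h (A *m intr_mx R U)
                         = (((p *m U) 0 h)%:~R)%:M.
    rewrite -col_mulmx mulmxA /A /intr_mx map_col_mx map_mx1 mul_row_col
      mul0mx.
    rewrite add0r mulmx1 -map_mxM; apply/matrixP => u v.
    by rewrite !ord1 !mxE mulr1n.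
  have -> : ip p (dsubmx g) = (row_mx 0 (intr_mx R p) *m g) 0 0.
    by rewrite [in RHS]gE mul_row_col mul0mx add0r.
  rewrite /g AU mul_gs ?colW ?mxE ?mulr1n // => h lt_hj.
  have ph0 : (p *m U) 0 h = 0.
    by apply: (IHd h) => //; [rewrite -jd | exact: ltn_trans lt_jl].
  by rewrite colW ph0 raddf0.
(* The linear form (1, - a) vanishes on all columns of A, which expresses that
   g = A z with z its lower block. *)
have ag : usubmx g 0 0 = ip a (dsubmx g).
  have colW (h : 'I_n) :
      row_mx 1%:M (- intr_mx R a) *m col h (A *m intr_mx R U) = 0.
    rewrite -col_mulmx mulmxA /A /intr_mx map_col_mx map_mx1 mul_row_col
      mul1mx.
    by rewrite mulmx1 subrr mul0mx; apply/matrixP => u v; rewrite !mxE.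
  have : row_mx 1%:M (- intr_mx R a) *m g = 0.
    by rewrite /g AU mul_gs ?colW // => h _; rewrite colW.
  rewrite gE mul_row_col mul1mx mulNmx -gE => /eqP.
  by rewrite subr_eq0 => /eqP ->.
have q_ge1 : 1 <= `|ip p (dsubmx g)|.
  by rewrite pg -intr_norm ler1z -gtz0_ge1 normr_gt0.
have M_ge0 : 0 <= M%:~R :> R.
  by apply/ltW/(le_lt_trans _ M_gt); rewrite mulr_ge0 ?sqr_ge0 ?enorm_ge0.
have g2 : enorm g ^+ 2 = ip a (dsubmx g) ^+ 2 + enorm (dsubmx g) ^+ 2.
  by rewrite enorm_col_mx_sqr enorm_sqr_dot /dot big_ord1 ag -expr2.
have ag_le : `|ip a (dsubmx g)| <= enorm g.
  rewrite -(@ler_pXn2r _ 2) ?nnegrE ?enorm_ge0 // real_normK ?num_real // g2.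
  by rewrite lerDl sqr_ge0.
have dg_le : enorm (dsubmx g) <= enorm g.
  rewrite -(@ler_pXn2r _ 2) ?nnegrE ?enorm_ge0 // g2.
  by rewrite lerDr sqr_ge0.
have rg_le := le_trans (ip_le_enorm _ _ r (dsubmx g))
  (ler_wpM2l (enorm_ge0 _ _ _ _) (le_trans dg_le g_le)).
have M_le : M%:~R <= `|ip a (dsubmx g)| + `|ip r (dsubmx g)|.
  apply: le_trans (ler_normB _ _); rewrite ip_comb addrK normrM.
  by rewrite (ger0_norm M_ge0) ler_peMr.
move: M_gt; rewrite ltNge => /negP; apply.
apply: le_trans M_le _; apply: le_trans (lerD (le_trans ag_le g_le) rg_le) _.
by rewrite le_eqVlt; apply/orP; left; apply/eqP; ring.
Qed.

End Reformulation.

Theorem theorem1 (R : realType) (n : nat) (p r : 'rV[int]_n) (k M : int)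
    (p_gt0 : forall i, 0 < p 0 i)
    (k_bounds : 0 <= k < \sum_i p 0 i)
    (M_large : 2 * Num.sqrt n%:R * (enorm (intr_mx R r) + 1) ^+ 2
                 * enorm (intr_mx R p) + 1 < M%:~R) :
  let a : 'rV[int]_n := M *: p + r in
  let u : 'cV[int]_n := const_mx 1 in
  let admissible (b1 b2 : int) : Prop :=
    [/\ (k * M)%:~R + Num.sqrt n%:R * enorm (intr_mx R r) < b1%:~R,
        b1 <= b2
      & b2%:~R < - (Num.sqrt n%:R * enorm (intr_mx R r)) + ((k + 1) * M)%:~R] in
  (exists b1 b2 : int, admissible b1 b2) /\
  forall b1 b2 : int, admissible b1 b2 ->
    [/\ proven_by_split (KP_LP R a b1 b2 u) p k,
        forall s : 'S_n, (2 ^ ell p k <= size (bb_nodes R a b1 b2 u s))%N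
      & forall U : 'M[int]_n, KZ_rangespace R a U ->
          forall y : 'cV[R]_n, rangespace_LP R a b1 b2 u U y ->
            forall i : 'I_n, i.+1 = n -> y i 0 \isn't a Num.int].
Proof.
have n_gt0 : (0 < n)%N.
  case: n p k_bounds {p_gt0 M_large r} => // p; rewrite big_ord0.
  by case/andP=> /le_lt_trans h /h; rewrite ltxx.
have sqrtn_ge1 : 1 <= Num.sqrt n%:R :> R.
  by rewrite -[leLHS]sqrtr1 ler_wsqrtr // ler1n.
have p_ge1 : 1 <= enorm (intr_mx R p) by exact: enorm_pos_ge1.
have r_ge0 : 0 <= enorm (intr_mx R r) by exact: enorm_ge0.
(* M > 2 sqrt n C + 1 leaves room for an integer between the two margins, and
   M > C is what forces p U to vanish before its last entry. *)
pose C : R := (enorm (intr_mx R r) + 1) ^+ 2 * enorm (intr_mx R p).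
have r_le_C : enorm (intr_mx R r) <= C by rewrite /C; nra.
have C_ge0 : 0 <= C by exact: le_trans r_le_C.
have C_lt : 2 * Num.sqrt n%:R * C + 1 < M%:~R by rewrite /C mulrA.
have C_lt_M : C < M%:~R by nra.
have M_gt0 : 0 < M by rewrite -(ltr0z R) (le_lt_trans C_ge0).
move=> a u admissible.
set err := Num.sqrt n%:R * enorm (intr_mx R r) in admissible *.
split.
  pose b := Num.floor ((k * M)%:~R + err) + 1.
  have b_gt : (k * M)%:~R + err < b%:~R by exact: floorD1_gt.
  have b_le : b%:~R <= (k * M)%:~R + err + 1.
    by rewrite /b intrD lerD2r floor_le.
  exists b, b; split=> //; apply: le_lt_trans b_le _.
  rewrite mulrDl mul1r [in ltRHS]intrD.
  have : err <= Num.sqrt n%:R * C by rewrite ler_wpM2l // (le_trans ler01).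
  by lra.
move=> b1 b2 [b1_gt le_b12 b2_lt]; split.
- exact: KP_LP_proven_by_split.
- move=> s; have [le_ell ell_sets] := ell_spec _ _ _ k_bounds.
  have feasible (N : node n) : (#|N.2| <= ell p k)%N ->
      (forall i, i \in N.2 -> 0 <= N.1 i 0 <= 1) ->
      node_feasible R a b1 b2 u N.
    move=> le_N N01.
    apply: (node_feasible_01 _ _ _ _ k _ _ _ _ _ _ (ell p k)) => //.
    by rewrite le_N.
  rewrite /bb_nodes feasible ?cards0 //; last by move=> i; rewrite inE.
  have := size_subtree_ge R n a b1 b2 (ell p k) [seq s t | t <- enum 'I_n]
    (root_node n) feasible.
  rewrite cards0 subn0 add0n size_map size_enum_ord; apply=> //.
  + by rewrite (map_inj_uniq perm_inj) enum_uniq.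
  + by move=> j _; rewrite inE.
  + by move=> i; rewrite inE.
- move=> U [U_unit KZ] y [/andP[b1_le le_b2] y_box] i last_i; apply/negP.
  move=> /intrP[z yz].
  have x01 j : 0 <= (intr_mx R U *m y) j 0 <= 1.
    by have := y_box j; rewrite [u _ _]mxE.
  have px : ip p (intr_mx R U *m y) = ((p *m U) 0 i * z)%:~R.
    rewrite -ip_mulmx ip_sum (bigD1 i) //= big1 ?addr0 => [|j neq_ji].
      by rewrite yz intrM.
    have -> : (p *m U) 0 j = 0; last by rewrite mul0r.
    apply: (KZ_split_direction R n p r M U p_gt0 C_lt_M U_unit KZ j i).
    rewrite ltn_neqAle -val_eqE in neq_ji *.
    by rewrite neq_ji -ltnS last_i ltn_ord.
  rewrite ip_mulmx in b1_le le_b2.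
  have [px_le|px_gt] := leP ((p *m U) 0 i * z) k.
    have /ip_lt_b1 : ip p (intr_mx R U *m y) <= k%:~R by rewrite px ler_int.
    by move=> /(_ r M b1 M_gt0 b1_gt x01); rewrite ltNge b1_le.
  have /b2_lt_ip : (k + 1)%:~R <= ip p (intr_mx R U *m y).
    by rewrite px ler_int lezD1.
  by move=> /(_ r M b2 M_gt0 b2_lt x01); rewrite ltNge le_b2.
Qed.
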